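(* For a positive integer $k$, let $f(k)$ be the maximum number of edges in a $k$-vertex oriented graph $D$ that is tournament anti-Sidorenko. Then $$k\log_2 k - O(k) \le f(k) \le k\log_2 k.$$
   Context: All digraphs are oriented graphs: no self-loops and no pair of antiparallel edges. A tournament is an orientation of a complete graph (exactly one directed edge between each pair of distinct vertices, no loops). For digraphs $D$ and $T$, a homomorphism $D\to T$ is a map $\phi:V(D)\to V(T)$ with $(\phi(x),\phi(y))\in E(T)$ whenever $(x,y)\in E(D)$; $h_D(T)$ is the number of homomorphisms and $t_D(T)=h_D(T)/v(T)^{v(D)}$ is the homomorphism density. A digraph $D$ is tournament anti-Sidorenko if $t_D(T)\le 2^{-e(D)}$ for every tournament $T$. *)

(* Defs.v *)
From HB Require Import structures.
From mathcomp Require Import all_boot all_order all_algebra.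
From mathcomp Require Import boolp reals exp.

Set Implicit Arguments.
Unset Strict Implicit.
Unset Printing Implicit Defensive.

Import Order.TTheory GRing.Theory Num.Theory.
Local Open Scope ring_scope.

(* A digraph on the finite vertex type V is given by its edge set
   E : {set V * V}; hence v(D) = #|V| and e(D) = #|E|. *)

Definition loopless (V : finType) (E : {set V * V}) : bool :=
  [forall x, (x, x) \notin E].

Definition oriented (V : finType) (E : {set V * V}) : bool :=
  loopless E && [forall x, forall y, ~~ (((x, y) \in E) && ((y, x) \in E))].

Definition tournament (V : finType) (E : {set V * V}) : bool :=
  loopless E &&
  [forall x, forall y, (x != y) ==> (((x, y) \in E) (+) ((y, x) \in E))].

Definition is_hom (V W : finType) (D : {set V * V}) (T : {set W * W})
    (phi : {ffun V -> W}) : bool :=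
  [forall x, forall y, ((x, y) \in D) ==> ((phi x, phi y) \in T)].

Definition hom_count (V W : finType) (D : {set V * V}) (T : {set W * W}) : nat :=
  #|[set phi : {ffun V -> W} | is_hom D T phi]|.

Definition hom_density (V W : finType) (D : {set V * V}) (T : {set W * W}) : rat :=
  (hom_count D T)%:R / #|W|%:R ^+ #|V|.

(* The density is only meaningful for a tournament with at least one vertex. *)
Definition anti_sidorenko (V : finType) (D : {set V * V}) : Prop :=
  forall (W : finType) (T : {set W * W}),
    (0 < #|W|)%N -> tournament T -> hom_density D T <= 2 ^- #|D|.

(* The range of the maximum is nonempty: it contains the edgeless digraph. *)
Definition max_edges (k : nat) : nat :=
  \max_(D : {set 'I_k * 'I_k} | oriented D && `[< anti_sidorenko D >]) #|D|.

Definition log2 (R : realType) (x : R) : R := ln x / ln 2.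

(* Main.v *)
(** The ancestor-descendant pairs of a balanced binary search tree, oriented by
the search order, form an anti-Sidorenko digraph: if the root is mapped to [r],
the two subtrees, of [a] vertices each, are mapped independently into the in- and
out-neighbourhoods of [r], whose sizes add up to less than [n], so induction
gives at most [n (n/2)^(2a)] times the two densities, while the root carries
exactly [2a] edges. The number of edges is the total depth of the tree, which is
[k log2 k - O(k)]. Conversely, a [k]-vertex [D] extends to a tournament on its own
vertex set, which receives at least one homomorphism, so
[k^(-k) <= 2^(- e(D))]. *)
Require Import Defs.
From mathcomp Require Import all_boot all_order all_algebra.
From mathcomp Require Import boolp reals exp.
From mathcomp Require Import zify.

Import Order.TTheory GRing.Theory Num.Theory.
Local Open Scope ring_scope.

(** * Oriented graphs given by edge sets, and counting their edges *)

Section EdgeSets.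
Set Implicit Arguments.
Unset Strict Implicit.
Local Open Scope nat_scope.
Implicit Types V W : finType.

Lemma orientedP V (D : {set V * V}) :
  reflect ((forall x, (x, x) \notin D) /\
           (forall x y, (x, y) \in D -> (y, x) \notin D)) (oriented D).
Proof.
apply: (iffP andP) => -[].
  move=> /forallP lD /forallP aD; split=> // x y xy.
  by move: (aD x) => /forallP/(_ y); rewrite xy.
move=> lD aD; split; first exact/forallP.
by do 2!apply/forallP => ?; apply/negP => /andP[/aD/negP].
Qed.

Lemma tournament_oriented W (T : {set W * W}) : tournament T -> oriented T.
Proof.
move=> /andP[lT /forallP tT]; apply/orientedP; split; first exact/forallP.
move=> x y xy; have neq_xy : x != y.
  by apply: contraTneq xy => ->; move/forallP: lT.
by move/forallP: (tT x) => /(_ y)/implyP/(_ neq_xy); rewrite xy.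
Qed.

Lemma sum_option V (F : option V -> nat) :
  \sum_x F x = F None + \sum_x F (Some x).
Proof.
rewrite (bigD1 None) //= (reindex_omap Some id) => [|[]] //=.
by congr (_ + _); apply: eq_bigl => x; rewrite eqxx.
Qed.

(** As a double sum, the edge count splits along [option] and sum types, the vertex types of the
    constructions below. *)
Lemma card_edges V (D : {set V * V}) : #|D| = \sum_x \sum_y ((x, y) \in D).
Proof.
rewrite pair_bigA -sum1_card big_mkcond; apply: eq_bigr => -[x y] _ /=.
by case: ifP.
Qed.

Lemma is_homP V W (D : {set V * V}) (T : {set W * W}) (phi : {ffun V -> W}) :
  reflect (forall x y, (x, y) \in D -> (phi x, phi y) \in T) (is_hom D T phi).
Proof.
apply: (iffP forallP) => [H x y xy | H x].
  by move: (H x) => /forallP/(_ y)/implyP; apply.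
by apply/forallP => y; apply/implyP; apply: H.
Qed.

(** * Homomorphisms with image in a subset of the target *)

Definition homs_into V W (D : {set V * V}) (T : {set W * W}) (A : {set W}) :=
  [set phi : {ffun V -> W} | is_hom D T phi & [forall x, phi x \in A]].

Lemma homs_intoP V W (D : {set V * V}) (T : {set W * W}) (A : {set W})
    (phi : {ffun V -> W}) :
  reflect ((forall x y, (x, y) \in D -> (phi x, phi y) \in T) /\
           (forall x, phi x \in A))
          (phi \in homs_into D T A).
Proof.
by rewrite inE; apply: (iffP andP) => -[/is_homP ? /forallP].
Qed.

(* Quantifying over all subsets [A] of the target makes the bound inductive. *)
Definition few_homs V (D : {set V * V}) : Prop :=
  forall W (T : {set W * W}) (A : {set W}), oriented T ->
    #|homs_into D T A| * 2 ^ #|D| <= #|A| ^ #|V|.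

Lemma few_homs_anti_sidorenko V (D : {set V * V}) :
  few_homs D -> anti_sidorenko D.
Proof.
move=> fD W T W_gt0 /tournament_oriented/(fD _ _ [set: W]).
have -> : #|homs_into D T [set: W]| = hom_count D T.
  apply: eq_card => phi; rewrite !inE andb_idr // => _.
  by apply/forallP => x; rewrite inE.
rewrite cardsT => le_homs; rewrite /hom_density.
rewrite ler_pdivrMr ?exprn_gt0 ?ltr0n // ler_pdivlMl ?exprn_gt0 //.
by rewrite mulrC -!natrX -natrM ler_nat.
Qed.

(** * Two constructions: an added isolated vertex, and two copies joined by a root *)

Definition isolate V (D : {set V * V}) : {set option V * option V} :=
  [set p | if p is (Some x, Some y) then (x, y) \in D else false].

Lemma card_isolate V (D : {set V * V}) : #|isolate D| = #|D|.
Proof.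
rewrite !card_edges sum_option /= big1 => [|? _]; last by rewrite inE.
rewrite add0n; apply: eq_bigr => x _; rewrite sum_option /= inE.
by apply: eq_bigr => y _; rewrite inE.
Qed.

Lemma oriented_isolate V (D : {set V * V}) : oriented D -> oriented (isolate D).
Proof.
move=> /orientedP[lD aD]; apply/orientedP.
by split=> [[x|]|[x|] [y|]]; rewrite !inE //; apply: aD.
Qed.

(** The new vertex [None] multiplies the count by at most [#|A|], matching the one extra factor on
    the right. *)
Lemma few_homs_isolate V (D : {set V * V}) : few_homs D -> few_homs (isolate D).
Proof.
move=> fD W T A oT; rewrite card_isolate card_option expnS.
pose split_hom (phi : {ffun option V -> W}) :=
  (phi None, [ffun x => phi (Some x)]).
have split_inj : injective split_hom.
  move=> phi psi [eqN /ffunP eqS]; apply/ffunP => -[x|] //.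
  by have := eqS x; rewrite !ffunE.
apply: leq_trans (leq_mul (leqnn #|A|) (fD W T A oT)).
rewrite mulnA leq_mul2r -cardsX -(card_imset _ split_inj); apply/orP; right.
apply/subset_leq_card/subsetP => _ /imsetP[phi /homs_intoP[hom_phi phiA] ->].
rewrite inE phiA /=; apply/homs_intoP; split=> [x y xy|x]; rewrite !ffunE //.
by apply: hom_phi; rewrite inE.
Qed.

(** The root is [None]; edges run from the left copy to it and from it to the right copy. The
    in-order left-root-right would also join left to right by transitivity, but those pairs are not
    edges. *)
Definition tree_join V (D : {set V * V}) :
    {set option (V + V) * option (V + V)} :=
  [set p | match p with
           | (Some (inl x), Some (inl y)) | (Some (inr x), Some (inr y)) =>
               (x, y) \in D
           | (Some (inl _), None) | (None, Some (inr _)) => true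
           | _ => false
           end].

Lemma card_tree_join V (D : {set V * V}) :
  #|tree_join D| = 2 * #|D| + 2 * #|V|.
Proof.
pose inD := fun x y : V => ((x, y) \in D : nat).
have rowE (F : option (V + V) -> nat) :
    \sum_y F y = F None + (\sum_y F (Some (inl y)) + \sum_y F (Some (inr y))).
  by rewrite sum_option big_sumType.
rewrite !card_edges !rowE inE.
have -> : \sum_y ((None, Some (inl y)) \in tree_join D) = 0.
  by rewrite big1 // => y _; rewrite inE.
have -> : \sum_y ((None, Some (inr y)) \in tree_join D) = #|V|.
  by rewrite -sum1_card; apply: eq_bigr => y _; rewrite inE.
have -> : \sum_x \sum_y ((Some (inl x), y) \in tree_join D) =
          #|V| + \sum_x \sum_y inD x y.
  rewrite -sum1_card -big_split; apply: eq_bigr => x _; rewrite rowE inE /=.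
  congr (_ + _); rewrite [X in _ + X]big1 ?addn0 => [|y _]; last by rewrite inE.
  by apply: eq_bigr => y _; rewrite inE.
have -> : \sum_x \sum_y ((Some (inr x), y) \in tree_join D) =
          \sum_x \sum_y inD x y.
  apply: eq_bigr => x _; rewrite rowE inE /= add0n.
  rewrite big1 ?add0n => [|y _]; last by rewrite inE.
  by apply: eq_bigr => y _; rewrite inE.
by rewrite /inD; lia.
Qed.

Lemma oriented_tree_join V (D : {set V * V}) :
  oriented D -> oriented (tree_join D).
Proof.
move=> /orientedP[lD aD]; apply/orientedP.
by split=> [[[x|x]|]|[[x|x]|] [[y|y]|]]; rewrite !inE //; apply: aD.
Qed.

Lemma few_homs_tree_join V (D : {set V * V}) :
  few_homs D -> few_homs (tree_join D).
Proof.
move=> fD W T A oT; rewrite card_tree_join card_option card_sum.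
have /orientedP[lT aT] := oT.
pose I r := [set w in A | (w, r) \in T].
pose O r := [set w in A | (r, w) \in T].
pose F r := [set phi in homs_into (tree_join D) T A | phi None == r].
have card_IO r : #|I r| + #|O r| <= #|A|.
  have disjIO : I r :&: O r = set0.
    apply/setP => w; rewrite !inE.
    by apply/negP => /andP[/andP[_ /aT/negP ?] /andP[]].
  rewrite -cardsUI disjIO cards0 addn0; apply: subset_leq_card.
  by apply/subsetP => w; rewrite !inE; case/orP => /andP[].
(* Once the root goes to [r], a map is determined by its restrictions to the two copies, which land
   in [I r] and [O r]. *)
have card_F r : #|F r| <= #|homs_into D T (I r)| * #|homs_into D T (O r)|.
  pose split_hom (phi : {ffun option (V + V) -> W}) :=
    ([ffun x => phi (Some (inl x))], [ffun x => phi (Some (inr x))]).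
  rewrite -cardsX -(@card_in_imset _ _ split_hom); last first.
    move=> phi psi /setIdP[_ /eqP phiN] /setIdP[_ /eqP psiN].
    move=> /pair_equal_spec[/ffunP eql /ffunP eqr].
    apply/ffunP => -[[x|x]|]; last by rewrite phiN psiN.
      by have := eql x; rewrite !ffunE.
    by have := eqr x; rewrite !ffunE.
  apply/subset_leq_card/subsetP => _ /imsetP[phi phiF ->].
  case/setIdP: phiF => /homs_intoP[hom_phi phiA] /eqP phiN; rewrite inE /=.
  apply/andP; split; apply/homs_intoP.
    split=> [x y xy|x]; rewrite !ffunE; first by apply: hom_phi; rewrite inE.
    by rewrite inE phiA -phiN hom_phi // inE.
  split=> [x y xy|x]; rewrite !ffunE; first by apply: hom_phi; rewrite inE.
  by rewrite inE phiA -phiN hom_phi // inE.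
have -> : #|homs_into (tree_join D) T A| = \sum_(r in A) #|F r|.
  rewrite -sum1_card.
  rewrite (partition_big (fun phi : {ffun _ -> W} => phi None) (mem A)) /=.
    apply: eq_bigr => r _; rewrite -sum1_card.
    by apply: eq_bigl => phi; rewrite [RHS]inE.
  by move=> phi /homs_intoP[].
rewrite big_distrl expnS -sum_nat_const; apply: leq_sum => r _ /=.
(* AM-GM: the factor 4, raised to the power [#|V|], pays for the [2 * #|V|] edges at the root. *)
have amgm : #|I r| * #|O r| * (2 * 2) <= #|A| * #|A|.
  rewrite mulnC (leq_trans (nat_AGM2 _ _).1) // -mulnn.
  exact: leq_mul.
have -> : 2 ^ (2 * #|D| + 2 * #|V|) = 2 ^ #|D| * 2 ^ #|D| * (2 * 2) ^ #|V|.
  by rewrite expnD mul2n -addnn expnD expnM.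
have -> : #|A| ^ (#|V| + #|V|) = (#|A| * #|A|) ^ #|V| by rewrite expnD expnMn.
apply: (@leq_trans ((#|I r| * #|O r| * (2 * 2)) ^ #|V|)); last first.
  by have [->|V_gt0] := posnP #|V|; rewrite ?expn0 ?leq_exp2r.
rewrite mulnA [leqRHS]expnMn leq_mul // expnMn.
apply: leq_trans (leq_mul (fD W T (I r) oT) (fD W T (O r) oT)).
by rewrite mulnACA leq_mul.
Qed.

(** * Transport to ordinals and the edge count of the balanced tree *)

Lemma card_reindex V V' (f : V -> V') (g : V' -> V) (D : {set V * V}) :
  cancel f g -> cancel g f -> #|[set p | (g p.1, g p.2) \in D]| = #|D|.
Proof.
move=> fK gK.
rewrite -[RHS](@on_card_preimset _ _ (fun p : V' * V' => (g p.1, g p.2))).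
  by apply: eq_card => p; rewrite !inE.
by apply: onW_bij; exists (fun p : V * V => (f p.1, f p.2)) => -[x y] /=;
   rewrite ?fK ?gK.
Qed.

(** Composition with [f] injects the homomorphisms of the relabelled digraph into those of [D]. This
    is needed because [max_edges] ranges over digraphs on ordinals. *)
Lemma few_homs_reindex V V' (f : V -> V') (g : V' -> V) (D : {set V * V}) :
  cancel f g -> cancel g f -> few_homs D ->
  few_homs [set p | (g p.1, g p.2) \in D].
Proof.
move=> fK gK fD W T A oT.
have -> : #|V'| = #|V| by apply: bij_eq_card; exists f.
rewrite (card_reindex _ fK gK); apply: leq_trans (fD W T A oT); rewrite leq_mul2r.
pose pull (phi : {ffun V' -> W}) := [ffun x => phi (f x)].
have pull_inj : injective pull.
  move=> phi psi /ffunP eq_pull; apply/ffunP => x.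
  by have := eq_pull (g x); rewrite !ffunE gK.
rewrite -(card_imset _ pull_inj); apply/orP; right.
apply/subset_leq_card/subsetP => _ /imsetP[phi /homs_intoP[hom_phi phiA] ->].
apply/homs_intoP; split=> [x y xy|x]; rewrite !ffunE //.
by apply: hom_phi; rewrite inE /= !fK.
Qed.

Lemma few_homs_max_edges V (D : {set V * V}) :
  oriented D -> few_homs D -> #|D| <= max_edges #|V|.
Proof.
move=> oD fD; pose g : 'I_#|V| -> V := enum_val.
pose f : V -> 'I_#|V| := enum_rank.
have fK : cancel f g := enum_rankK; have gK : cancel g f := enum_valK.
rewrite -(card_reindex D fK gK).
rewrite /max_edges; apply: leq_bigmax_cond; apply/andP; split.
  move: oD => /orientedP[lD aD]; apply/orientedP.
  by split=> [x|x y]; rewrite !inE //; apply: aD.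
by apply/asboolP/few_homs_anti_sidorenko/(few_homs_reindex fK gK fD).
Qed.

(* A subtree size [a] yields trees with [2a + 1] and, adding an isolated vertex,
   [2a + 2] vertices; the shift in [(k + 2) ^ (k + 2)] makes the second step
   [k + 2 = 2 (a + 2)] homogeneous. *)
Lemma dense_few_homs k :
  exists (V : finType) (D : {set V * V}),
    [/\ #|V| = k, oriented D, few_homs D &
        (k + 2) ^ (k + 2) <= 2 ^ #|D| * 2 ^ (6 * k + 2)].
Proof.
elim/ltn_ind: k => k IHk.
have [->|k_gt0] := posnP k.
  exists void, set0; rewrite card_void cards0; split=> //.
    by apply/orientedP; split=> -[].
  move=> W T A _; rewrite cards0 card_void muln1 expn0.
  by apply: leq_trans (max_card _) _; rewrite card_ffun card_void expn0.
have a_lt : k.-1./2 < k by lia.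
have [V [D [cardV oD fD szD]]] := IHk _ a_lt.
set a := k.-1./2 in a_lt cardV szD.
(* This serves both parities: the left side is that of [k = 2 * a + 2], the exponent on the right
   that of [k = 2 * a + 1]. The powers of two balance exactly: with a bound [c * k + d] the step
   needs [d + 4 <= c] and the case [k = 0] needs [2 <= d], whence 6 and 2. *)
have sz2 : (2 * a + 4) ^ (2 * a + 4) <=
    2 ^ (2 * #|D| + 2 * #|V|) * 2 ^ (6 * (2 * a + 1) + 2).
  have -> : 2 * a + 4 = (a + 2) * 2 by lia.
  rewrite expnMn expnM.
  apply: (@leq_trans ((2 ^ #|D| * 2 ^ (6 * a + 2)) ^ 2 * 2 ^ ((a + 2) * 2))).
    by rewrite leq_mul2r leq_sqr szD orbT.
  by rewrite -!expnD -expnM -expnD leq_exp2l // cardV; lia.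
have [k_odd|k_even] := boolP (odd k).
  exists (option (V + V)), (tree_join D).
  split; [by rewrite card_option card_sum; lia | exact: oriented_tree_join |
          exact: few_homs_tree_join | ].
  rewrite card_tree_join; have -> : k = 2 * a + 1 by lia.
  apply: leq_trans sz2; apply: (@leq_trans ((2 * a + 4) ^ (2 * a + 1 + 2))).
    by rewrite leq_exp2r; lia.
  by rewrite leq_exp2l; lia.
exists (option (option (V + V))), (isolate (tree_join D)).
split; [by rewrite !card_option card_sum; lia |
        exact/oriented_isolate/oriented_tree_join |
        exact/few_homs_isolate/few_homs_tree_join | ].
rewrite card_isolate card_tree_join; have -> : k = 2 * a + 2 by lia.
rewrite -addnA; apply: leq_trans sz2 _.
by rewrite leq_mul2l leq_exp2l //; lia.
Qed.

(** * The upper bound, by completing the digraph to a tournament *)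

Lemma anti_sidorenko_card k (D : {set 'I_k * 'I_k}) :
  0 < k -> oriented D -> anti_sidorenko D -> 2 ^ #|D| <= k ^ k.
Proof.
move=> k_gt0 /orientedP[lD aD] asD.
(* Pairs not joined in [D] are oriented upwards; the identity is then a homomorphism from [D] to
   [T]. *)
pose T := D :|: [set p : 'I_k * 'I_k | (p.1 < p.2) && ((p.2, p.1) \notin D)].
have tT : tournament T.
  apply/andP; split; first by apply/forallP => x; rewrite !inE ltnn orbF.
  apply/forallP => x; apply/forallP => y; apply/implyP => neq_xy.
  rewrite !inE /=; case: (boolP ((x, y) \in D)) => [/aD/negbTE -> /=|xyD].
    by rewrite andbF.
  case: (boolP ((y, x) \in D)) => [|yxD] //=; first by rewrite andbF.
  by rewrite !andbT; case: ltngtP neq_xy => // /val_inj ->; rewrite eqxx.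
have hom_gt0 : 0 < hom_count D T.
  rewrite card_gt0; apply/set0Pn; exists [ffun x => x]; rewrite inE.
  by apply/is_homP => x y xy; rewrite !ffunE !inE xy.
have := asD _ T; rewrite card_ord => /(_ k_gt0 tT).
rewrite /hom_density card_ord ler_pdivrMr ?exprn_gt0 ?ltr0n //.
rewrite ler_pdivlMl ?exprn_gt0 // -!natrX -natrM ler_nat => le_hom.
by apply: leq_trans le_hom; apply: leq_pmulr.
Qed.

End EdgeSets.

(** * Passage from powers of two to logarithms *)

Section Log2.
Variable R : realType.

Lemma log2X (x : R) n : 0 < x -> log2 (x ^+ n) = n%:R * log2 x.
Proof. by move=> x_gt0; rewrite /log2 lnXn // -[ln x *+ n]mulr_natl mulrA. Qed.

Lemma ln2_gt0 : 0 < ln 2 :> R.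
Proof. by rewrite ln_gt0 // ltr1n. Qed.

Lemma log2_2X n : log2 (2 ^+ n : R) = n%:R.
Proof. by rewrite log2X ?ltr0n // /log2 divff ?mulr1 // gt_eqF ?ln2_gt0. Qed.

Lemma le_log2 (x y : R) : 0 < x -> x <= y -> log2 x <= log2 y.
Proof.
move=> x_gt0 le_xy; rewrite /log2 ler_pM2r ?invr_gt0 ?ln2_gt0 //.
by rewrite ler_ln ?posrE // (lt_le_trans x_gt0).
Qed.

End Log2.

Theorem theorem1p7 (R : realType) :
  (exists C : R, forall k : nat, (0 < k)%N ->
     k%:R * log2 (k%:R : R) - C * k%:R <= (max_edges k)%:R) /\
  (forall k : nat, (0 < k)%N ->
     (max_edges k)%:R <= k%:R * log2 (k%:R : R)).
Proof.
split; last first.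
  move=> k k_gt0; rewrite -log2X ?ltr0n // -[leLHS]log2_2X.
  apply: le_log2; first by rewrite exprn_gt0.
  rewrite -!natrX ler_nat /max_edges.
  (* The first case is the default value 0 of the maximum, where [1 <= k ^ k] is needed. *)
  elim/big_ind: _ => [|m n le_m le_n|D /andP[oD /asboolP asD]].
  - by rewrite expn_gt0 k_gt0.
  - by rewrite /maxn; case: ifP.
  - exact: anti_sidorenko_card.
(* The constant comes from [6 * k + 2 <= 8 * k] for positive [k]. *)
exists 8%:R => k k_gt0.
have [V [D [cardV oD fD szD]]] := dense_few_homs k.
have le_max : (#|D| <= max_edges k)%N by rewrite -cardV few_homs_max_edges.
rewrite lerBlDr -natrM -natrD -log2X ?ltr0n // -[leRHS]log2_2X.
apply: le_log2; first by rewrite exprn_gt0 ?ltr0n.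
rewrite -!natrX ler_nat.
apply: (@leq_trans ((k + 2) ^ (k + 2))%N).
  apply: (@leq_trans ((k + 2) ^ k)%N); first by rewrite leq_exp2r //; lia.
  by rewrite leq_exp2l; lia.
apply: leq_trans szD _; rewrite -expnD leq_exp2l //; lia.
Qed.
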